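(* Let $1\le p\le n-1$, $1\le j\le n-p$, and let $J$ be an $n\times n$ symmetric tri-diagonal matrix with diagonal entries $b_1,\ldots,b_n$ and off-diagonal entries $a_1,\ldots,a_{n-1}$ satisfying $\operatorname{Im}b_1>0$, $b_k\in\mathbb{R}$ for $k=2,\ldots,n$, $a_k>0$ for $k\neq p$, and $a_p=0$. Write $c_{2k-1}=b_k$ and $c_{2k}=a_k$. Suppose that the $p$ non-real eigenvalues $z_1,\ldots,z_p$ of $J$, counted with algebraic multiplicity, and $j$ distinct real eigenvalues of $J$ are given, as well as the entries $c_{2p+j+1},\ldots,c_{2n-1}$. Then these data uniquely determine the matrix $J$; that is, any two $n\times n$ symmetric tri-diagonal matrices, each having diagonal entries $b_1,\ldots,b_n$ and off-diagonal entries $a_1,\ldots,a_{n-1}$ that satisfy $\operatorname{Im}b_1>0$, $b_k\in\mathbb{R}$ for $k=2,\ldots,n$, $a_k>0$ for $k\neq p$, and $a_p=0$ (with the same $p$), which have the same non-real eigenvalues $z_1,\ldots,z_p$ counted with algebraic multiplicity, which both have the given $j$ distinct real numbers among their eigenvalues, and which have the same entries $c_{2p+j+1},\ldots,c_{2n-1}$, coincide.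
   Context: The symmetric tri-diagonal matrix with diagonal entries $b_1,\ldots,b_n$ and off-diagonal entries $a_1,\ldots,a_{n-1}$ is the $n\times n$ matrix with $b_k$ in position $(k,k)$, with $a_k$ in both positions $(k,k+1)$ and $(k+1,k)$, and zeros elsewhere. Its entries are regarded as a single sequence $\{c_k\}_{k=1}^{2n-1}$, $c_{2k-1}=b_k$, $c_{2k}=a_k$. *)

(* Defs.v *)
From HB Require Import structures.
From mathcomp Require Import all_boot all_order all_algebra.
From mathcomp Require Import complex reals.
Set Implicit Arguments.
Unset Strict Implicit.
Unset Printing Implicit Defensive.
Import Order.TTheory GRing.Theory Num.Theory.
Local Open Scope ring_scope.
Local Open Scope complex_scope.

(* Entry sequences are indexed from 1; only b_1, ..., b_n and a_1, ..., a_(n-1)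
   occur in the matrix. Ordinals start at 0, hence the shifts. *)
Definition tridiag (C : nzRingType) (n : nat) (a b : nat -> C) : 'M[C]_n :=
  \matrix_(i < n, j < n)
    if i == j :> nat then b i.+1
    else if j == i.+1 :> nat then a i.+1
    else if i == j.+1 :> nat then a j.+1
    else 0.

(* c_(2k-1) = b_k and c_(2k) = a_k. *)
Definition entry_seq (C : Type) (a b : nat -> C) (k : nat) : C :=
  if odd k then b k.+1./2 else a k./2.

(* In R[i], both [0 < x] and [x \is Num.real] entail that x has zero
   imaginary part. *)
Definition admissible (R : realType) (n p : nat) (a b : nat -> R[i]) : Prop :=
  [/\ 0 < complex.Im (b 1),
      forall k, (2 <= k <= n)%N -> b k \is Num.real,
      forall k, (1 <= k <= n - 1)%N -> k <> p -> 0 < a k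
    & a p = 0].

Definition alg_mult (C : fieldType) (n : nat) (J : 'M[C]_n) (w : C) : nat :=
  mup w (char_poly J).

Definition nonreal_eigenvalues (R : realType) (n : nat) (J : 'M[R[i]]_n)
    (z : seq R[i]) : Prop :=
  (forall w, w \in z -> w \isn't Num.real) /\
  (forall w, w \isn't Num.real -> count_mem w z = alg_mult J w).

(* Main.v *)
Require Import Defs.
From HB Require Import structures.
From mathcomp Require Import all_boot all_order all_algebra.
From mathcomp Require Import complex reals.
From mathcomp Require Import ring zify.
Set Implicit Arguments.
Unset Strict Implicit.
Unset Printing Implicit Defensive.
Import Order.TTheory GRing.Theory Num.Theory.
Local Open Scope ring_scope.
Local Open Scope complex_scope.

(* Since a_p = 0, the characteristic polynomial of J is P Q, with P and Q those
   of the leading p x p block and of the trailing block. P has no real root and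
   Q has only real roots, so the non-real eigenvalues determine P. If P1 is the
   (real) polynomial of the first block without its first row and column, then
   P - conj P = (conj b_1 - b_1) P1, so P determines P1, and the Euclidean
   algorithm on (P, P1) recovers the first block. For the trailing block, let
   (P_k, P_(k-1)) and (P'_k, P'_(k-1)) be the polynomials of the leading
   sub-blocks containing the unknown entries. The common known tail forces
   a'_k^2 P_k P'_(k-1) - a_k^2 P_(k-1) P'_k to vanish at the j given real
   eigenvalues, while its degree is less than j. Hence it is zero, and
   coprimality with monicity gives P_k = P'_k and P_(k-1) = P'_(k-1). *)

(** * Characteristic polynomials of tri-diagonal blocks *)

(** Characteristic polynomial of the block on rows [s+1] to [s+l], expanded along its first row. The
    offset [s] lets all sub-blocks share the sequences [a] and [b]. *)
Fixpoint jacobi_poly (R : nzRingType) (a b : nat -> R) (s l : nat) : {poly R} :=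
  match l with
  | 0 => 1
  | l1.+1 =>
    let lead := ('X - (b s.+1)%:P) * jacobi_poly a b s.+1 l1 in
    match l1 with
    | 0 => lead
    | l2.+1 => lead - a s.+1 ^+ 2 *: jacobi_poly a b s.+2 l2
    end
  end.
Arguments jacobi_poly : simpl never.

Lemma det_tridiag_rec (R : comNzRingType) (n : nat) (a b : nat -> R) :
  \det (tridiag n.+2 a b) =
    b 1%N * \det (tridiag n.+1 (a \o succn) (b \o succn))
    - a 1%N ^+ 2 * \det (tridiag n (a \o succn \o succn) (b \o succn \o succn)).
Proof.
rewrite (expand_det_row _ ord0) 2!big_ord_recl big1 ?addr0 => [|i _]; last first.
  by rewrite !mxE /= mul0r.
rewrite !mxE /= /cofactor /= expr0 expr1 mul1r; congr (_ * \det _ + _).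
  by apply/matrixP => i j; rewrite !mxE.
(* In the minor of the (1,2) entry, the first column has [a 1] on top and zeros below. *)
rewrite (expand_det_col _ ord0) big_ord_recl big1 ?addr0 => [|i _]; last first.
  by rewrite !mxE /= mul0r.
rewrite !mxE /= /cofactor /= expr0 mul1r mulN1r mulrN mulrA; congr (- (_ * \det _)).
by apply/matrixP => i j; rewrite !mxE.
Qed.

Section JacobiPoly.

Variable R : comNzRingType.
Implicit Types (a b : nat -> R) (s k l : nat).

Lemma jacobi_polySS a b s l :
  jacobi_poly a b s l.+2 = ('X - (b s.+1)%:P) * jacobi_poly a b s.+1 l.+1
                           - a s.+1 ^+ 2 *: jacobi_poly a b s.+2 l.
Proof. by []. Qed.

Lemma jacobi_poly1 a b s : jacobi_poly a b s 1 = 'X - (b s.+1)%:P.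
Proof. by rewrite /jacobi_poly mulr1. Qed.

Lemma char_poly_tridiag a b s l :
  char_poly (tridiag l (fun k => a (s + k)%N) (fun k => b (s + k)%N)) =
    jacobi_poly a b s l.
Proof.
have charE : char_poly (tridiag l (fun k => a (s + k)%N) (fun k => b (s + k)%N)) =
    \det (tridiag l (fun k => - (a (s + k)%N)%:P)
                    (fun k => 'X - (b (s + k)%N)%:P)).
  congr (\det _); apply/matrixP => i j; rewrite !mxE -val_eqE /=.
  case: eqP => [_|_]; first by rewrite mulr1n.
  by rewrite mulr0n sub0r; do 2?case: ifP => // _; rewrite polyC0 oppr0.
rewrite {}charE; elim/ltn_ind: l s => -[|[|l]] IH s.
- by rewrite det_mx00.
- by rewrite det_mx11 mxE addn1 jacobi_poly1.
rewrite det_tridiag_rec jacobi_polySS -!IH // addn1 sqrrN -rmorphXn /= -mul_polyC.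
congr (_ * _ - _ * _); congr (\det _); apply/matrixP => i j; rewrite !mxE /=.
  by rewrite !addnS !addSn.
by rewrite !addnS !addSn.
Qed.

Lemma eq_jacobi_poly a b a' b' s l :
  (forall i, (s < i <= s + l)%N -> b i = b' i) ->
  (forall i, (s < i < s + l)%N -> a i = a' i) ->
  jacobi_poly a b s l = jacobi_poly a' b' s l.
Proof.
elim/ltn_ind: l s => -[|[|l]] IH s eqb eqa //.
  by rewrite !jacobi_poly1 eqb //; lia.
rewrite !jacobi_polySS eqb ?eqa; try lia.
by rewrite !IH // => i hi; (apply: eqb || apply: eqa); lia.
Qed.

Lemma size_jacobi_poly_monic a b s l :
  (size (jacobi_poly a b s l) == l.+1) && (jacobi_poly a b s l \is monic).
Proof.
elim/ltn_ind: l s => -[|[|l]] IH s.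
- by rewrite /jacobi_poly size_poly1 monic1 eqxx.
- by rewrite jacobi_poly1 size_XsubC monicXsubC eqxx.
have /andP[/eqP sz1 mon1] := IH l.+1 (leqnn _) s.+1.
have /andP[/eqP sz2 mon2] := IH l (ltnW (leqnn _)) s.+2.
have szM : size (('X - (b s.+1)%:P) * jacobi_poly a b s.+1 l.+1) = l.+3.
  by rewrite size_monicM ?monicXsubC ?monic_neq0 // size_XsubC sz1.
have lt_sz : (size (- (a s.+1 ^+ 2 *: jacobi_poly a b s.+2 l)) < l.+3)%N.
  by rewrite size_polyN (leq_ltn_trans (size_scale_leq _ _)) // sz2; lia.
rewrite jacobi_polySS size_polyDl szM // eqxx /= monicE lead_coefDl ?szM //.
by rewrite -monicE monicMl ?monicXsubC.
Qed.

Lemma size_jacobi_poly a b s l : size (jacobi_poly a b s l) = l.+1.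
Proof. by case/andP: (size_jacobi_poly_monic a b s l) => /eqP. Qed.

Lemma jacobi_poly_monic a b s l : jacobi_poly a b s l \is monic.
Proof. by case/andP: (size_jacobi_poly_monic a b s l). Qed.

(** The block is cut after row [s+k+1], where [a (s+k+1)] is the only coupling. Both sides satisfy
    the same three-term recurrence in [k]. *)
Lemma jacobi_poly_split a b s k l :
  jacobi_poly a b s (k.+1 + l.+1) =
    jacobi_poly a b s k.+1 * jacobi_poly a b (s + k.+1) l.+1
    - a (s + k.+1)%N ^+ 2 *: (jacobi_poly a b s k * jacobi_poly a b (s + k.+2) l).
Proof.
elim/ltn_ind: k s => -[|[|k]] IH s.
- by rewrite add1n jacobi_polySS jacobi_poly1 addn1 addn2 mul1r.
- rewrite add2n jacobi_polySS (jacobi_polySS _ _ s.+1) (jacobi_polySS _ _ s 0).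
  rewrite !jacobi_poly1 addn2 addn3 /= -!mul_polyC; ring.
have -> : (k.+3 + l.+1 = (k.+1 + l.+1).+2)%N by [].
rewrite jacobi_polySS (IH k.+1) // (IH k) // (jacobi_polySS _ _ s k.+1).
rewrite (jacobi_polySS _ _ s k) !addSn !addnS -!mul_polyC; ring.
Qed.

Lemma jacobi_poly_rcons a b s k :
  jacobi_poly a b s k.+2 =
    ('X - (b (s + k.+2)%N)%:P) * jacobi_poly a b s k.+1
    - a (s + k.+1)%N ^+ 2 *: jacobi_poly a b s k.
Proof.
have -> : jacobi_poly a b s k.+2 = jacobi_poly a b s (k.+1 + 1) by rewrite addn1.
rewrite jacobi_poly_split jacobi_poly1 mulrC -addnS.
by congr (_ - _ *: _); apply: mulr1.
Qed.

Lemma jacobi_poly_split0 a b s k l : a (s + k)%N = 0 ->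
  jacobi_poly a b s (k + l) = jacobi_poly a b s k * jacobi_poly a b (s + k) l.
Proof.
case: k => [|k]; first by rewrite addn0 mul1r.
case: l => [|l] ask0; first by rewrite addn0 mulr1.
by rewrite jacobi_poly_split ask0 expr0n scale0r subr0.
Qed.

End JacobiPoly.

(** * Coprimality and the Euclidean algorithm for consecutive block polynomials *)

Section JacobiPolyField.

Variable K : fieldType.
Implicit Types (a b : nat -> K) (s k l : nat) (P Q S : {poly K}).

Lemma coprimep_three_term P Q S (c : K) :
  c != 0 -> coprimep Q S -> coprimep (P * Q - c *: S) Q.
Proof.
move=> c0 coQS.
by rewrite coprimep_sym coprimep_addl_mul -scaleNr coprimepZr ?oppr_eq0.
Qed.

(** One Euclidean step: as [S] is smaller than [Q], quotient ['X - u%:P] and remainder [- c *: S]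
    are unique, and monicity separates [c] from [S]. *)
Lemma three_term_inj Q S S' (u v c c' : K) :
    S \is monic -> S' \is monic -> (size S < size Q)%N -> size S = size S' ->
    c != 0 ->
    ('X - u%:P) * Q - c *: S = ('X - v%:P) * Q - c' *: S' ->
  [/\ u = v, c = c' & S = S'].
Proof.
move=> monS monS' ltSQ eqSS' c0 eqPQ.
have diffE : (v - u) *: Q = c *: S - c' *: S'.
  apply/eqP; rewrite -subr_eq0 -!mul_polyC; apply/eqP.
  transitivity (('X - u%:P) * Q - c *: S - (('X - v%:P) * Q - c' *: S')).
    by rewrite polyCB -!mul_polyC; ring.
  by rewrite eqPQ subrr.
have uv : u = v.
  apply/eqP; rewrite eq_sym -subr_eq0; apply: contraLR ltSQ => vu0.
  rewrite -leqNgt -(size_scale Q vu0) diffE (leq_trans (size_polyD _ _)) //.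
  rewrite size_polyN geq_max (leq_trans (size_scale_leq _ _)) //.
  by rewrite (leq_trans (size_scale_leq _ _)) ?eqSS'.
move: diffE; rewrite uv subrr scale0r => /esym/subr0_eq eqS.
have := congr1 lead_coef eqS.
rewrite !lead_coefZ !(monicP _) // !mulr1 => cc'.
by split=> //; move: eqS; rewrite -cc' => /(scalerI c0).
Qed.

Lemma jacobi_poly_coprime_behead a b s l :
    (forall i, (s < i <= s + l)%N -> a i != 0) ->
  coprimep (jacobi_poly a b s l.+1) (jacobi_poly a b s.+1 l).
Proof.
elim: l s => [|l IH] s a0; first by rewrite coprimep1.
rewrite jacobi_polySS coprimep_three_term ?IH ?expf_neq0 ?a0 //; first lia.
by move=> i hi; apply: a0; lia.
Qed.

Lemma jacobi_poly_coprime_belast a b s l :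
    (forall i, (s < i <= s + l)%N -> a i != 0) ->
  coprimep (jacobi_poly a b s l.+1) (jacobi_poly a b s l).
Proof.
elim: l => [|l IH] a0; first by rewrite coprimep1.
rewrite jacobi_poly_rcons coprimep_three_term ?IH ?expf_neq0 ?a0 //; first lia.
by move=> i hi; apply: a0; lia.
Qed.

(** Each Euclidean step recovers one diagonal entry, one squared off-diagonal entry and the next
    remainder. Only squares can come out, since the recurrence contains only [a s.+1 ^+ 2]. *)
Lemma jacobi_poly_inj_behead a b a' b' s l :
    (forall i, (s < i <= s + l)%N -> a i != 0) ->
    jacobi_poly a b s l.+1 = jacobi_poly a' b' s l.+1 ->
    jacobi_poly a b s.+1 l = jacobi_poly a' b' s.+1 l ->
  (forall i, (s < i <= s + l.+1)%N -> b i = b' i) /\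
  (forall i, (s < i <= s + l)%N -> a i ^+ 2 = a' i ^+ 2).
Proof.
elim: l s => [|l IH] s a0.
  rewrite !jacobi_poly1 => /addrI/oppr_inj/polyC_inj eqb _.
  by split=> i hi; [have -> : i = s.+1 by lia | lia].
rewrite !jacobi_polySS => eqP eqQ; move: eqP; rewrite -eqQ => eqP.
have [] := three_term_inj _ _ _ _ _ eqP;
  rewrite ?jacobi_poly_monic ?size_jacobi_poly ?expf_neq0 ?a0 //; first lia.
move=> eqb eqa eqS; have [|eqB eqA] := IH s.+1 _ eqQ eqS.
  by move=> i hi; apply: a0; lia.
split=> i hi.
  by have [-> //|si] := eqVneq i s.+1; apply: eqB; lia.
by have [-> //|si] := eqVneq i s.+1; apply: eqA; lia.
Qed.

(** The same algorithm, peeling off the last row through [jacobi_poly_rcons]. *)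
Lemma jacobi_poly_inj_belast a b a' b' s l :
    (forall i, (s < i <= s + l)%N -> a i != 0) ->
    jacobi_poly a b s l.+1 = jacobi_poly a' b' s l.+1 ->
    jacobi_poly a b s l = jacobi_poly a' b' s l ->
  (forall i, (s < i <= s + l.+1)%N -> b i = b' i) /\
  (forall i, (s < i <= s + l)%N -> a i ^+ 2 = a' i ^+ 2).
Proof.
elim: l => [|l IH] a0.
  rewrite !jacobi_poly1 => /addrI/oppr_inj/polyC_inj eqb _.
  by split=> i hi; [have -> : i = s.+1 by lia | lia].
rewrite !jacobi_poly_rcons => eqP eqQ; move: eqP; rewrite -eqQ => eqP.
have [] := three_term_inj _ _ _ _ _ eqP;
  rewrite ?jacobi_poly_monic ?size_jacobi_poly ?expf_neq0 ?a0 //; first lia.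
move=> eqb eqa eqS; have [|eqB eqA] := IH _ eqQ eqS.
  by move=> i hi; apply: a0; lia.
split=> i hi.
  by have [-> //|si] := eqVneq i (s + l.+2)%N; apply: eqB; lia.
by have [-> //|si] := eqVneq i (s + l.+1)%N; apply: eqA; lia.
Qed.

End JacobiPolyField.

(** * Uniqueness of a block from some eigenvalues and its last entries *)

Section MixedData.

Variable K : fieldType.
Implicit Types (a b : nat -> K) (P Q S : {poly K}) (xs : seq K).

Lemma size_sub_monic P Q :
  P \is monic -> Q \is monic -> size P = size Q ->
  (size (P - Q)%R <= (size P).-1)%N.
Proof.
move=> monP monQ eqPQ; apply/leq_sizeP => i.
rewrite leq_eqVlt coefB => /predU1P[<-|lti].
  move: (monicP monP) (monicP monQ); rewrite !lead_coefE -eqPQ => -> ->.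
  exact: subrr.
by rewrite !nth_default -?eqPQ ?subrr // (leq_trans (leqSpred _)).

Qed.

(** Too many roots for its size make the combination zero. Then [P] divides [Q * P'], hence [P'] by
    coprimality, so [P = P'] by size and monicity; cancelling [P] leaves [c' *: Q' = c *: Q]. *)
Lemma wronskian_inj P P' Q Q' (c c' : K) xs :
    P \is monic -> P' \is monic -> Q \is monic -> Q' \is monic ->
    size P = size P' -> size Q = size Q' -> coprimep P Q ->
    c != 0 -> c' != 0 -> uniq xs ->
    all (root (c' *: (P * Q') - c *: (Q * P'))) xs ->
    (size (c' *: (P * Q') - c *: (Q * P'))%R <= size xs)%N ->
  [/\ P = P', Q = Q' & c = c'].
Proof.
move=> monP monP' monQ monQ' eqPP' eqQQ' coPQ c0 c'0 uxs rxs szxs.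
have /subr0_eq eqW := roots_geq_poly_eq0 rxs uxs szxs.
have PP' : P = P'.
  apply/eqP; rewrite -eqp_monic // -dvdp_size_eqp ?eqPP' //.
  rewrite -(Gauss_dvdpr _ coPQ) -(dvdpZr _ _ c0) -eqW.
  by rewrite dvdpZr ?dvdp_mulr.
move: eqW; rewrite -PP' (mulrC Q) !scalerAr => /(mulfI (monic_neq0 monP)) eqQ.
have := congr1 lead_coef eqQ; rewrite !lead_coefZ !(monicP _) // !mulr1 => cc'.
by split=> //; move: eqQ; rewrite cc' => /(scalerI c0).
Qed.

(* At a common eigenvalue the two splitting identities are linear relations
   with the same nonzero coefficient vector, given by the common tail. *)
Lemma jacobi_poly_cross a b a' b' s k l (x : K) :
    (forall i, (s + k.+1 < i < s + (k.+1 + l.+1))%N -> a i != 0) ->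
    (forall i, (s + k.+1 < i <= s + (k.+1 + l.+1))%N -> b i = b' i) ->
    (forall i, (s + k.+1 < i < s + (k.+1 + l.+1))%N -> a i = a' i) ->
    root (jacobi_poly a b s (k.+1 + l.+1)) x ->
    root (jacobi_poly a' b' s (k.+1 + l.+1)) x ->
  root (a' (s + k.+1)%N ^+ 2 *:
          (jacobi_poly a b s k.+1 * jacobi_poly a' b' s k)
        - a (s + k.+1)%N ^+ 2 *:
          (jacobi_poly a b s k * jacobi_poly a' b' s k.+1)) x.
Proof.
move=> a0 eqb eqa; rewrite !jacobi_poly_split.
rewrite -(@eq_jacobi_poly _ a b a' b' (s + k.+1) l.+1);
  [|by move=> i hi; apply: eqb; lia|by move=> i hi; apply: eqa; lia].
rewrite -(@eq_jacobi_poly _ a b a' b' (s + k.+2) l);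
  [|by move=> i hi; apply: eqb; lia|by move=> i hi; apply: eqa; lia].
have : coprimep (jacobi_poly a b (s + k.+1) l.+1) (jacobi_poly a b (s + k.+2) l).
  rewrite (addnS s k.+1); apply: jacobi_poly_coprime_behead => i hi.
  by apply: a0; lia.
move/(@coprimep_root _ _ _ x).
set T := jacobi_poly a b _ l.+1; set U := jacobi_poly a b _ l.
set P := jacobi_poly a b s k.+1; set P' := jacobi_poly a' b' s k.+1.
set Q := jacobi_poly a b s k; set Q' := jacobi_poly a' b' s k.
rewrite /root !(hornerD, hornerN, hornerZ, hornerM) => TU /eqP eP /eqP eP'.
set W := (X in X == 0).
have WT : T.[x] * W = 0.
  transitivity (a' (s + k.+1)%N ^+ 2 * Q'.[x] *
      (P.[x] * T.[x] - a (s + k.+1)%N ^+ 2 * (Q.[x] * U.[x]))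
    - a (s + k.+1)%N ^+ 2 * Q.[x] *
      (P'.[x] * T.[x] - a' (s + k.+1)%N ^+ 2 * (Q'.[x] * U.[x]))).
    by rewrite /W; ring.
  by rewrite eP eP' !mulr0 subrr.
have WU : U.[x] * W = 0.
  transitivity (P'.[x] *
      (P.[x] * T.[x] - a (s + k.+1)%N ^+ 2 * (Q.[x] * U.[x]))
    - P.[x] *
      (P'.[x] * T.[x] - a' (s + k.+1)%N ^+ 2 * (Q'.[x] * U.[x]))).
    by rewrite /W; ring.
  by rewrite eP eP' !mulr0 subrr.
have [T0|T0] := eqVneq T.[x] 0.
  have U0 := TU (introT eqP T0).
  by move/eqP: WU; rewrite mulf_eq0 (negPf U0).
by move/eqP: WT; rewrite mulf_eq0 (negPf T0).
Qed.

(** With j = [size xs], the two bounds on [i] read 2i-1 >= 2s+j+1 and 2i >= 2s+j+1: the entries of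
    the block from c_(2s+j+1) on agree. *)
Lemma jacobi_mixed_data a b a' b' s m xs :
    (0 < size xs <= m)%N -> uniq xs ->
    (forall i, (s < i < s + m)%N -> a i != 0) ->
    (forall i, (s < i < s + m)%N -> a' i != 0) ->
    all (root (jacobi_poly a b s m)) xs ->
    all (root (jacobi_poly a' b' s m)) xs ->
    (forall i, (i <= s + m)%N -> (2 * s + size xs + 2 <= 2 * i)%N ->
       b i = b' i) ->
    (forall i, (i < s + m)%N -> (2 * s + size xs + 1 <= 2 * i)%N ->
       a i = a' i) ->
  (forall i, (s < i <= s + m)%N -> b i = b' i) /\
  (forall i, (s < i < s + m)%N -> a i ^+ 2 = a' i ^+ 2).
Proof.
move=> hxs uxs a0 a'0 rxs rxs' eqb eqa.
(* A 1 x 1 block cannot be cut in two; its eigenvalue is its entry. *)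
have [m1|m1] := eqVneq m 1%N.
  case: xs {uxs eqb eqa} hxs rxs rxs' => //= x xs _.
  rewrite m1 /= !jacobi_poly1 !root_XsubC => /andP[/eqP -> _] /andP[/eqP eqb _].
  by split=> i hi; [have -> : i = s.+1 by lia | lia].
(* So [size xs] is 2k+1 or 2k+2: the first k+1 rows contain every unknown diagonal entry, and the
   coupling [a (s+k+1)] is known exactly in the odd case. *)
pose k := ((size xs).-1)./2; pose l := (m - k.+2)%N.
have mE : m = (k.+1 + l.+1)%N by lia.
have szW : (size (a' (s + k.+1)%N ^+ 2 *:
          (jacobi_poly a b s k.+1 * jacobi_poly a' b' s k)
        - a (s + k.+1)%N ^+ 2 *:
          (jacobi_poly a b s k * jacobi_poly a' b' s k.+1))%R <= size xs)%N.
  have szM (u v u' v' : nat -> K) c d :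
      size (jacobi_poly u v s c * jacobi_poly u' v' s d) = (c + d).+1.
    by rewrite size_monicM ?jacobi_poly_monic ?monic_neq0 ?jacobi_poly_monic //
      !size_jacobi_poly addnS.
  (* Both products have size 2k+2, which suffices in the even case. In the odd case the couplings
     agree and the monic leading terms cancel, which lowers the size to 2k+1. *)
  have [odd_xs|even_xs] := boolP (odd (size xs)).
    rewrite eqa; [|lia|lia].
    rewrite -scalerBr (leq_trans (size_scale_leq _ _)) //.
    rewrite (leq_trans (size_sub_monic _ _ _)) ?monicMl ?jacobi_poly_monic //;
      rewrite ?szM; lia.
  rewrite (leq_trans (size_polyD _ _)) // size_polyN geq_max.
  by rewrite !(leq_trans (size_scale_leq _ _)) // szM; lia.
have rW : all (root (a' (s + k.+1)%N ^+ 2 *: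
          (jacobi_poly a b s k.+1 * jacobi_poly a' b' s k)
        - a (s + k.+1)%N ^+ 2 *:
          (jacobi_poly a b s k * jacobi_poly a' b' s k.+1))) xs.
  apply/allP => x xin; apply: (@jacobi_poly_cross _ _ _ _ _ _ l).
  - by move=> i hi; apply: a0; lia.
  - by move=> i hi; apply: eqb; lia.
  - by move=> i hi; apply: eqa; lia.
  - by rewrite -mE; apply: (allP rxs).
  - by rewrite -mE; apply: (allP rxs').
have [eqP eqQ eqak] : [/\ jacobi_poly a b s k.+1 = jacobi_poly a' b' s k.+1,
    jacobi_poly a b s k = jacobi_poly a' b' s k
    & a (s + k.+1)%N ^+ 2 = a' (s + k.+1)%N ^+ 2].
  apply: (wronskian_inj _ _ _ _ _ _ _ _ _ uxs rW szW);
    rewrite ?jacobi_poly_monic ?size_jacobi_poly ?expf_neq0 ?a0 ?a'0 //; try lia.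
  by apply: jacobi_poly_coprime_belast => i hi; apply: a0; lia.
have [|eqB eqA] := jacobi_poly_inj_belast _ eqP eqQ.
  by move=> i hi; apply: a0; lia.
split=> i hi.
  by have [ki|ki] := leqP i (s + k.+1); [apply: eqB|apply: eqb]; lia.
have [ki|ki|-> //] := ltngtP i (s + k.+1); first by apply: eqA; lia.
by rewrite eqa //; lia.
Qed.

End MixedData.

(** * Real and non-real roots of block polynomials *)

Section ComplexJacobi.

Variable C : numClosedFieldType.
Implicit Types (a b : nat -> C) (s l : nat) (w : C).

Lemma conj_jacobi_poly a b s l :
    (forall i, (s < i <= s + l)%N -> b i \is Num.real) ->
    (forall i, (s < i < s + l)%N -> a i \is Num.real) ->
  map_poly Num.conj (jacobi_poly a b s l) = jacobi_poly a b s l.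
Proof.
elim/ltn_ind: l s => -[|[|l]] IH s realb reala.
- exact: rmorph1.
- rewrite !jacobi_poly1 rmorphB /= map_polyX map_polyC /=.
  by rewrite conj_Creal ?realb //; lia.
rewrite !jacobi_polySS rmorphB rmorphM rmorphB /= map_polyX map_polyC /=.
rewrite map_polyZ rmorphXn /= !conj_Creal ?realb ?reala; try lia.
by rewrite !IH // => i hi; (apply: realb || apply: reala); lia.
Qed.

(* Im(w) Im(P(w) conj(Q(w))) > 0, scaled by 4, where P and Q are the polynomials
   of the block and of the block without its first row and column. *)
Lemma jacobi_poly_nevanlinna a b s l w :
    (forall i, (s < i <= s + l.+1)%N -> b i \is Num.real) ->
    (forall i, (s < i <= s + l)%N -> a i \is Num.real) ->
    w \isn't Num.real ->
  0 < (w - w^*)^* * ((jacobi_poly a b s l.+1).[w] * (jacobi_poly a b s.+1 l).[w]^*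
                    - (jacobi_poly a b s l.+1).[w]^* * (jacobi_poly a b s.+1 l).[w]).
Proof.
move=> realb reala wNR.
have d0 : 0 < (w - w^*) * (w - w^*)^*.
  by rewrite mul_conjC_gt0 subr_eq0 eq_sym -CrealE.
elim: l s realb reala => [|l IH] s realb reala.
  have -> : jacobi_poly a b s.+1 0 = 1 by [].
  rewrite jacobi_poly1 !hornerE rmorph1 !mulr1.
  rewrite (rmorphB _ w (b s.+1)) /= (conj_Creal (realb s.+1 _)); last lia.
  by rewrite opprB addrA subrK mulrC.
have realbS i : (s.+1 < i <= s.+1 + l.+1)%N -> b i \is Num.real.
  by move=> hi; apply: realb; lia.
have realaS i : (s.+1 < i <= s.+1 + l)%N -> a i \is Num.real.
  by move=> hi; apply: reala; lia.
have := IH s.+1 realbS realaS; set P := (jacobi_poly a b s.+1 l.+1).[w].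
rewrite jacobi_polySS !(hornerD, hornerN, hornerZ, hornerM, hornerX, hornerC) -/P.
set S := (jacobi_poly a b s.+2 l).[w].
move=> ltPS; have P0 : P != 0.
  by apply: contraTneq ltPS => ->; rewrite rmorph0 !mul0r subrr mulr0 ltxx.
have realbs := conj_Creal (realb s.+1 _); have realas := conj_Creal (reala s.+1 _).
rewrite !(rmorphB, rmorphM, rmorphXn) /= realbs ?realas; try lia.
(* A new first row multiplies the previous quantity by [a s.+1 ^+ 2] and adds |w - conj w|^2 |P|^2,
   which is positive because [P != 0]. *)
rewrite [ltRHS](_ : _ = (w - w^*) * (w - w^*)^* * (P * P^*) +
   a s.+1 ^+ 2 * ((w - w^*)^* * (P * S^* - P^* * S))); last first.
  by rewrite rmorphB /=; ring.
apply: ltr_wpDr; last by apply: mulr_gt0; rewrite // mul_conjC_gt0.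
rewrite mulr_ge0 ?(ltW ltPS) //.
by rewrite real_exprn_even_ge0 // reala //; lia.
Qed.

(** At a non-real root the positive quantity of [jacobi_poly_nevanlinna] would vanish. *)
Lemma jacobi_poly_real_roots a b s l w :
    (forall i, (s < i <= s + l)%N -> b i \is Num.real) ->
    (forall i, (s < i < s + l)%N -> a i \is Num.real) ->
    root (jacobi_poly a b s l) w -> w \is Num.real.
Proof.
case: l => [|l] realb reala; first by rewrite /jacobi_poly (negPf (root1 _)).
move=> /rootP Pw; apply: contraT => wNR.
have := @jacobi_poly_nevanlinna a b s l w realb _ wNR.
by rewrite Pw rmorph0 !mul0r subrr mulr0 ltxx => -> // i hi; apply: reala; lia.
Qed.

(** In the first-row expansion [b s.+1] occurs only in the linear factor; all other coefficients are
    real, so they cancel or factor out. *)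
Lemma jacobi_poly_sub_conj a b s l :
    (forall i, (s.+1 < i <= s + l.+1)%N -> b i \is Num.real) ->
    (forall i, (s < i <= s + l)%N -> a i \is Num.real) ->
  jacobi_poly a b s l.+1 - map_poly Num.conj (jacobi_poly a b s l.+1) =
    ((b s.+1)^* - b s.+1) *: jacobi_poly a b s.+1 l.
Proof.
move=> realb reala; rewrite -mul_polyC polyCB.
case: l realb reala => [|l] realb reala.
  rewrite !jacobi_poly1 rmorphB /= map_polyX map_polyC /=; ring.
rewrite jacobi_polySS rmorphB rmorphM rmorphB /= map_polyX map_polyC /=.
rewrite map_polyZ rmorphXn /= (conj_Creal (reala s.+1 _)); last lia.
rewrite !conj_jacobi_poly; first (rewrite -!mul_polyC; ring);
  by move=> i hi; (apply: realb || apply: reala); lia.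
Qed.

(** A real root is also a root of the conjugate polynomial, hence by [jacobi_poly_sub_conj] of the
    polynomial without the first row, against coprimality. *)
Lemma jacobi_poly_nonreal_roots a b s l w :
    b s.+1 \isn't Num.real ->
    (forall i, (s.+1 < i <= s + l.+1)%N -> b i \is Num.real) ->
    (forall i, (s < i <= s + l)%N -> a i \is Num.real) ->
    (forall i, (s < i <= s + l)%N -> a i != 0) ->
  root (jacobi_poly a b s l.+1) w -> w \isn't Num.real.
Proof.
move=> b1NR realb reala a0 Pw; apply/negP => wR.
have /negP[] := coprimep_root (jacobi_poly_coprime_behead b a0) Pw.
have := congr1 (horner^~ w) (jacobi_poly_sub_conj realb reala).
have Pcw : (map_poly Num.conj (jacobi_poly a b s l.+1)).[w] = 0.
  by rewrite -(conj_Creal wR) horner_map (rootP Pw) rmorph0.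
rewrite !(hornerD, hornerN, hornerZ) Pcw (rootP Pw) subrr.
move/esym/eqP; rewrite mulf_eq0 => /orP[|//].
by rewrite subr_eq0 -CrealE (negPf b1NR).
Qed.

(** Leading coefficients in [jacobi_poly_sub_conj] give conj b - b, which is nonzero; dividing by it
    yields the second polynomial needed by the Euclidean algorithm. *)
Lemma jacobi_poly_nonreal_inj a b a' b' s l :
    b s.+1 \isn't Num.real ->
    (forall i, (s.+1 < i <= s + l.+1)%N -> b i \is Num.real) ->
    (forall i, (s.+1 < i <= s + l.+1)%N -> b' i \is Num.real) ->
    (forall i, (s < i <= s + l)%N -> a i \is Num.real) ->
    (forall i, (s < i <= s + l)%N -> a' i \is Num.real) ->
    (forall i, (s < i <= s + l)%N -> a i != 0) ->
    jacobi_poly a b s l.+1 = jacobi_poly a' b' s l.+1 ->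
  (forall i, (s < i <= s + l.+1)%N -> b i = b' i) /\
  (forall i, (s < i <= s + l)%N -> a i ^+ 2 = a' i ^+ 2).
Proof.
move=> b1NR realb realb' reala reala' a0 eqP.
apply: jacobi_poly_inj_behead => //.
have := jacobi_poly_sub_conj realb reala.
rewrite eqP (jacobi_poly_sub_conj realb' reala') => eqQ.
have := congr1 lead_coef eqQ.
rewrite !lead_coefZ !(monicP (jacobi_poly_monic _ _ _ _)) !mulr1 => eqd.
move: eqQ; rewrite eqd => /scalerI -> //.
by rewrite subr_eq0 -CrealE.
Qed.

End ComplexJacobi.

Lemma Im_gt0_nonreal (R : rcfType) (w : R[i]) :
  0 < complex.Im w -> w \isn't Num.real.
Proof. by apply: contraTN => /RIm_real/complexI ->; rewrite ltxx. Qed.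

(** * Spectrum of an admissible matrix, split at [a p = 0] *)

Section DecoupledJacobi.

Variables (R : realType) (n p : nat) (a b : nat -> R[i]).
Hypothesis hab : admissible n p a b.

Lemma admissible_head_nonreal : b 1 \isn't Num.real.
Proof. by case: hab => /Im_gt0_nonreal. Qed.

Lemma admissible_diag_real i : (1 < i <= n)%N -> b i \is Num.real.
Proof. by case: hab => _ realb _ _; apply: realb. Qed.

Lemma admissible_offdiag_gt0 i : (0 < i < n)%N -> i != p -> 0 < a i.
Proof. by case: hab => _ _ a0 _ hi /eqP; apply: a0; lia. Qed.

Hypothesis hp : (1 <= p <= n - 1)%N.

Lemma admissible_char_poly :
  char_poly (tridiag n a b) = jacobi_poly a b 0 p * jacobi_poly a b p (n - p).
Proof.
rewrite -[LHS]/(char_poly (tridiag n (fun k => a (0 + k)%N) (fun k => b (0 + k)%N))).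
rewrite char_poly_tridiag; have {1}-> : n = (p + (n - p))%N by lia.
by rewrite jacobi_poly_split0 //; case: hab.
Qed.

Lemma admissible_tail_roots w :
  root (jacobi_poly a b p (n - p)) w -> w \is Num.real.
Proof.
apply: jacobi_poly_real_roots => i hi; first by apply: admissible_diag_real; lia.
by apply: gtr0_real; apply: admissible_offdiag_gt0; lia.
Qed.

Lemma admissible_head_roots w :
  root (jacobi_poly a b 0 p) w -> w \isn't Num.real.
Proof.
have -> : p = p.-1.+1 by lia.
apply: jacobi_poly_nonreal_roots => [|i hi|i hi|i hi].
- exact: admissible_head_nonreal.
- by apply: admissible_diag_real; lia.
- by apply: gtr0_real; apply: admissible_offdiag_gt0; lia.
- by apply: lt0r_neq0; apply: admissible_offdiag_gt0; lia.
Qed.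

(** Multiplicities are compared point by point: a real [w] counts zero on both sides, and at a
    non-real [w] the trailing factor does not vanish, so the head factor carries the whole
    multiplicity. *)
Lemma admissible_head_poly (z : seq R[i]) :
    nonreal_eigenvalues (tridiag n a b) z ->
  jacobi_poly a b 0 p = \prod_(w <- z) ('X - w%:P).
Proof.
move=> [zNR zcount].
have [r] := closed_field_poly_normal (jacobi_poly a b 0 p).
rewrite (monicP (jacobi_poly_monic _ _ _ _)) scale1r => Pr.
rewrite [LHS]Pr; apply: perm_big; apply/allP => w _; apply/eqP.
have [wR|wNR] := boolP (w \is Num.real).
  rewrite !(count_memPn _) //.
    by apply/negP => /zNR; rewrite wR.
  apply/negP; rewrite -root_prod_XsubC -Pr => /admissible_head_roots.
  by rewrite wR.
rewrite zcount // /alg_mult admissible_char_poly mupMl ?Pr ?mu_prod_XsubC //.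
by apply/negP => /admissible_tail_roots; apply/negP.
Qed.

Lemma admissible_tail_eigenvalue (t : R) :
  eigenvalue (tridiag n a b) t%:C -> root (jacobi_poly a b p (n - p)) t%:C.
Proof.
rewrite eigenvalue_root_char admissible_char_poly rootM => /orP[|//].
by move/admissible_head_roots/negP; case; rewrite complex_real.
Qed.

End DecoupledJacobi.

(** * Assembly of the two blocks *)

Theorem theorem5p7 (R : realType) (n p j : nat)
    (hp : (1 <= p <= n - 1)%N) (hj : (1 <= j <= n - p)%N)
    (z : p.-tuple R[i]) (x : j.-tuple R) (hx : uniq x)
    (a b a' b' : nat -> R[i])
    (hab : admissible n p a b) (hab' : admissible n p a' b')
    (hz : nonreal_eigenvalues (tridiag n a b) z)
    (hz' : nonreal_eigenvalues (tridiag n a' b') z)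
    (hreal : forall t : R, t \in x -> eigenvalue (tridiag n a b) t%:C)
    (hreal' : forall t : R, t \in x -> eigenvalue (tridiag n a' b') t%:C)
    (hc : forall k : nat, (2 * p + j + 1 <= k <= 2 * n - 1)%N ->
       entry_seq a b k = entry_seq a' b' k) :
  tridiag n a b = tridiag n a' b'.
Proof.
have apos := admissible_offdiag_gt0 hab.
have apos' := admissible_offdiag_gt0 hab'.
have breal := admissible_diag_real hab.
have breal' := admissible_diag_real hab'.
have [||||||eqb1 eqa1] := @jacobi_poly_nonreal_inj _ a b a' b' 0 p.-1
    (admissible_head_nonreal hab).
- by move=> i hi; apply: breal; lia.
- by move=> i hi; apply: breal'; lia.
- by move=> i hi; apply/gtr0_real/apos; lia.
- by move=> i hi; apply/gtr0_real/apos'; lia.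
- by move=> i hi; apply/lt0r_neq0/apos; lia.
- have -> : p.-1.+1 = p by lia.
  by rewrite (admissible_head_poly hab hp hz) (admissible_head_poly hab' hp hz').
pose xs := [seq t%:C | t <- x].
have szxs : size xs = j by rewrite size_map size_tuple.
have [||||||||eqb2 eqa2] := @jacobi_mixed_data _ a b a' b' p (n - p) xs.
- by rewrite szxs.
- by rewrite map_inj_uniq //; apply: complexI.
- by move=> i hi; apply/lt0r_neq0/apos; lia.
- by move=> i hi; apply/lt0r_neq0/apos'; lia.
- by apply/allP => _ /mapP[t /hreal ht ->]; apply: admissible_tail_eigenvalue.
- by apply/allP => _ /mapP[t /hreal' ht ->]; apply: admissible_tail_eigenvalue.
- move=> i hi1; rewrite szxs => hi2; have := hc (2 * i - 1)%N; rewrite /entry_seq.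
  have -> : odd (2 * i - 1) by lia.
  have -> : ((2 * i - 1).+1./2 = i)%N by lia.
  by apply; lia.
- move=> i hi1; rewrite szxs => hi2; have := hc (2 * i)%N; rewrite /entry_seq.
  have -> : odd (2 * i) = false by lia.
  have -> : ((2 * i)./2 = i)%N by lia.
  by apply; lia.
have eqb i : (0 < i <= n)%N -> b i = b' i.
  by move=> hi; have [ip|ip] := leqP i p; [apply: eqb1|apply: eqb2]; lia.
have eqa i : (0 < i < n)%N -> a i = a' i.
  move=> hi; have [->|ip] := eqVneq i p.
    by case: hab hab' => [_ _ _ ->] [].
  (* Away from [p], positivity of the off-diagonal entries turns equal squares into equal
     entries. *)
  apply/eqP; rewrite -(@eqrXn2 _ 2) ?ltW ?apos ?apos' //; apply/eqP.
  by have [ltip|ltip] := leqP i p; [apply: eqa1|apply: eqa2]; lia.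
apply/matrixP => i k; rewrite !mxE; have := ltn_ord i; have := ltn_ord k.
case: eqP => [_|_] ltk lti; first by apply: eqb.
case: eqP => [ki|_]; first by apply: eqa; rewrite ltn0Sn -ki.
by case: eqP => // ik; apply: eqa; rewrite ltn0Sn -ik.
Qed.
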